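(* Let $P\subset\mathbb{R}^d$ be a full-dimensional polytope. For $\mathbf z\in\mathbb{R}^d$ let $\bar{\mathbf z}=(1,\mathbf z)\in\mathbb{R}^{d+1}$. Then $$\mathrm{Vol}^\vee_{\mathbf z}(P)=\frac{\mathrm{adj}_{C(P)^*}(\bar{\mathbf z})}{B_{\mathbf z}(P)},\qquad\text{or equivalently,}\qquad \mathrm{adj}_{C(P)^*}(\bar{\mathbf z})=A_{\mathbf z}(P).$$
   Context: Support function: $h_P(\mathbf v)=-\min_{\mathbf y\in P}\langle\mathbf v,\mathbf y\rangle$, so $h_{P-\mathbf z}(\mathbf v)=h_P(\mathbf v)+\langle\mathbf v,\mathbf z\rangle$. The normal fan $\mathcal N(P)$ consists of the cones $C_F=\{\mathbf v:h_P(\mathbf v)=-\langle\mathbf v,\mathbf y\rangle\ \forall\mathbf y\in F\}$, $F$ a face of $P$. Fix one generator $\mathbf v$ for each ray of $\mathcal N(P)$ and let $V(\mathcal N(P))$ be the set of these. Let $\mathcal T$ be any triangulation of $\mathcal N(P)$ into full-dimensional simplicial cones generated by rays of $\mathcal N(P)$; for $C\in\mathcal T$ let $V(C)$ be its set of $d$ generators and $\det(C)$ their determinant. Define $$A_{\mathbf z}(P)=\sum_{C\in\mathcal T}|\det(C)|\prod_{\mathbf v\in V(\mathcal N(P))\setminus V(C)}h_{P-\mathbf z}(\mathbf v),\qquad B_{\mathbf z}(P)=\prod_{\mathbf v\in V(\mathcal N(P))}h_{P-\mathbf z}(\mathbf v),$$ and the dual volume function $\mathrm{Vol}^\vee_{\mathbf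 z}(P)=A_{\mathbf z}(P)/B_{\mathbf z}(P)$, a rational function of $\mathbf z$ (independent of $\mathcal T$ and of the generators). $C(P)=\{(t,t\mathbf y): t\ge0,\ \mathbf y\in P\}\subset\mathbb{R}^{d+1}$ is the cone over $P$, and $C^*=\{\mathbf w:\langle\mathbf w,\mathbf u\rangle\ge0\ \forall\mathbf u\in C\}$ is the dual cone. For a full-dimensional pointed polyhedral cone $C\subset\mathbb{R}^{d+1}$ with a chosen set $V(C)$ of generators of its extreme rays and any triangulation $T$ of $C$ into $(d+1)$-dimensional simplicial cones with generators in $V(C)$, the adjoint polynomial is $$\mathrm{adj}_C(\mathbf u)=\sum_{F\in T}|\det(F)|\prod_{\mathbf w\in V(C)\setminus V(F)}\langle\mathbf w,\mathbf u\rangle,\qquad \mathbf u\in\mathbb{R}^{d+1},$$ where $V(F)$ is the set of generators of $F$ and $\det(F)$ their determinant; it is independent of $T$. The extreme rays of $C(P)^*$ are generated by the vectors $\mathbf w=(h_P(\mathbf v),\mathbf v)$, $\mathbf v\in V(\mathcal N(P))$, and these are the generators used to define $\mathrm{adj}_{C(P)^*}$. *)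

(* Defs.v *)
From HB Require Import structures.
From mathcomp Require Import all_boot all_order all_algebra finmap.
From mathcomp Require Import all_classical all_reals.
Set Implicit Arguments.
Unset Strict Implicit.
Unset Printing Implicit Defensive.
Import Order.TTheory GRing.Theory Num.Theory.
Local Open Scope classical_set_scope.
Local Open Scope ring_scope.

Section Euclidean.
Context {R : realType} {n : nat}.
Implicit Types (A C : set 'rV[R]_n) (S V : {fset 'rV[R]_n}).

Definition dotv (u v : 'rV[R]_n) : R := (u *m v^T) 0 0.

Definition convex_hull S : set 'rV[R]_n :=
  [set x | exists c : 'rV[R]_n -> R,
    [/\ forall y, 0 <= c y, \sum_(y <- S) c y = 1
      & x = \sum_(y <- S) c y *: y]].

Definition affine_hull A : set 'rV[R]_n :=
  [set x | exists (S : {fset 'rV[R]_n}) (c : 'rV[R]_n -> R),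
    [/\ [set` S] `<=` A, \sum_(y <- S) c y = 1
      & x = \sum_(y <- S) c y *: y]].

Definition polytope A : Prop := exists S, A = convex_hull S.

Definition full_dimensional A : Prop := affine_hull A = setT.

Definition conic_hull S : set 'rV[R]_n :=
  [set x | exists c : 'rV[R]_n -> R,
    (forall y, 0 <= c y) /\ x = \sum_(y <- S) c y *: y].

Definition dual_cone C : set 'rV[R]_n :=
  [set w | forall u, C u -> 0 <= dotv w u].

(* The rows follow the enumeration order of S, on which only the sign of the
   determinant depends. *)
Definition absdet S : R := `| \det (\matrix_(k < n) nth 0 S k) |.

(* A full-dimensional simplicial cone is represented by its set of generators,
   which is then a basis of the ambient space. *)
Definition triangulation C V (T : {fset {fset 'rV[R]_n}}) : Prop :=
  [/\ forall F, F \in T -> (F `<=` V)%fset /\ basis_of fullv F,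
      \bigcup_(F in [set` T]) conic_hull F = C
    & forall F G, F \in T -> G \in T ->
        conic_hull F `&` conic_hull G = conic_hull (F `&` G)%fset].

Definition adjoint V (T : {fset {fset 'rV[R]_n}}) (u : 'rV[R]_n) : R :=
  \sum_(F <- T) absdet F * \prod_(w <- (V `\` F)%fset) dotv w u.

End Euclidean.

Section Polytope.
Context {R : realType} {d : nat}.
Implicit Types (P F C : set 'rV[R]_d) (v y z : 'rV[R]_d).
Implicit Types (V : {fset 'rV[R]_d}) (T : {fset {fset 'rV[R]_d}}).

(* On a nonempty polytope this infimum is a minimum. *)
Definition support_fun P v : R := - inf [set dotv v y | y in P].

Definition translate P z : set 'rV[R]_d := [set y - z | y in P].

(* Nonempty faces only, P included: the empty one would add the whole space
   to the normal fan. *)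
Definition face P F : Prop :=
  F !=set0 /\
  exists (a : 'rV[R]_d) (b : R),
    (forall y, P y -> b <= dotv a y) /\ F = P `&` [set y | dotv a y = b].

Definition normal_cone P F : set 'rV[R]_d :=
  [set v | forall y, F y -> support_fun P v = - dotv v y].

Definition normal_fan P : set (set 'rV[R]_d) :=
  [set normal_cone P F | F in face P].

Definition is_ray C : Prop :=
  exists2 v, v != 0 & C = conic_hull [fset v]%fset.

Definition ray_generators (N : set (set 'rV[R]_d)) V : Prop :=
  (forall v, v \in V -> v != 0 /\ N (conic_hull [fset v]%fset)) /\
  (forall C, N C -> is_ray C ->
     exists! v, v \in V /\ C = conic_hull [fset v]%fset).

(* The triangulation has the same support as the fan and refines it. *)
Definition fan_triangulation (N : set (set 'rV[R]_d)) V T : Prop :=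
  triangulation (\bigcup_(C in N) C) V T /\
  (forall S, S \in T -> exists2 C, N C & conic_hull S `<=` C).

Definition dual_vol_num P V T z : R :=
  \sum_(S <- T) absdet S *
    \prod_(v <- (V `\` S)%fset) support_fun (translate P z) v.

Definition dual_vol_den P V z : R :=
  \prod_(v <- V) support_fun (translate P z) v.

Definition dual_vol P V T z : R := dual_vol_num P V T z / dual_vol_den P V z.

Definition consv (t : R) v : 'rV[R]_(1 + d) := row_mx t%:M v.

Definition cone_over P : set 'rV[R]_(1 + d) :=
  [set u | exists t y, [/\ 0 <= t, P y & u = consv t (t *: y)]].

(* Generators of the extreme rays of the dual cone of cone_over P when V
   generates the rays of the normal fan of P. *)
Definition lifted_generators P V : {fset 'rV[R]_(1 + d)} :=
  [fset consv (support_fun P v) v | v in V]%fset.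

End Polytope.

(* Main.v *)
(**
The weight |det F| / prod_(w in F) <w,u> of a simplicial cone with generators F
is the integral of exp(-<.,u>) over it, and so depends additively on the
indicator function of the cone.  The triangulation T' of C(P)^* and the
simplicial cones spanned by (1,0) and the lifts (h_P(v),v), v in S, for S in T,
both decompose C(P)^* up to hyperplanes: over S the support function is linear,
and C(P)^* is its epigraph.  Since the latter cones have the determinants of
the S, and <(1,0),(1,z)> = 1, <(h_P(v),v),(1,z)> = h_{P-z}(v), comparing the sums
of weights at u = (1,z) and clearing denominators gives the theorem.

Additivity is proved without integrals, by induction on the dimension.  A
linear relation between indicator functions of cones, modulo cones containing
a line, is turned into relations one dimension lower by comparing, for each
direction w, the limits at both ends of the lines parallel to w.  Partial
fractions in one variable, with poles indexed by the generators w, express a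
weight through the weights of the quotient cones, so that these relations
cancel the poles one by one.
*)

Require Import Defs.
From HB Require Import structures.
From mathcomp Require Import all_boot all_order all_algebra finmap.
From mathcomp Require Import all_classical all_reals.
From mathcomp Require Import ring lra.
Set Implicit Arguments.
Unset Strict Implicit.
Unset Printing Implicit Defensive.
Import Order.TTheory GRing.Theory Num.Theory.
Local Open Scope classical_set_scope.
Local Open Scope ring_scope.

(** * Generic points and partial fractions *)

Lemma exists_nonroot (F : numDomainType) (p : {poly F}) :
  p != 0 -> exists t, ~~ root p t.
Proof.
move=> p0; pose rs : seq F := [seq i%:R | i <- iota 0 (size p)].
have urs : uniq rs.
  by rewrite map_inj_uniq ?iota_uniq // => i j /eqP; rewrite eqr_nat => /eqP.
have [all_r|/allPn [t _ nrt]] := boolP (all (root p) rs); last by exists t.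
by have := max_poly_roots p0 all_r urs; rewrite size_map size_iota ltnn.
Qed.

(** Each column is read as the coefficients of a polynomial; a common nonroot t of these gives the
    point (1, t, t^2, ...) of the moment curve. *)
Lemma exists_nonorthogonal (F : numDomainType) n (C : seq 'cV[F]_n) :
  (forall c, c \in C -> c != 0) ->
  exists xi : 'rV[F]_n, forall c, c \in C -> (xi *m c) 0 0 != 0.
Proof.
move=> C0; pose f (c : 'cV[F]_n) : {poly F} := rVpoly c^T.
have f0 c : c \in C -> f c != 0.
  move=> /C0; apply: contraNneq => fc0.
  by rewrite -[c]trmxK -[c^T]rVpolyK -/(f c) fc0 raddf0 trmx0.
have [|t] := @exists_nonroot F (\prod_(p <- map f C) p).
  by rewrite prodf_seq_neq0 all_map; apply/allP => c /f0.
rewrite root_bigmul => /allP nr.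
exists (\row_i t ^+ i) => c /(map_f f) /nr; apply: contraNN; rewrite mxE => /eqP fc.
rewrite /root /f /rVpoly horner_poly -[X in _ == X]fc; apply/eqP.
by apply: eq_bigr => i _; rewrite valK !mxE mulrC.
Qed.

(** Lagrange interpolation of the constant 1 at the nodes [s j], evaluated at 0. *)
Lemma prod_partial_fraction (F : fieldType) n (s : 'I_n.+1 -> F) :
  injective s -> (forall j, s j != 0) ->
  \prod_j (s j)^-1 = \sum_j (s j)^-1 * \prod_(i | i != j) (s i - s j)^-1.
Proof.
move=> s_inj s0.
pose L j := \prod_(i | i != j) (('X - (s i)%:P) * ((s j - s i)^-1)%:P).
pose Q := \sum_j L j - 1.
have Lk j k : (L j).[s k] = (j == k)%:R.
  rewrite horner_prod; have [<-|jk] := eqVneq j k.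
    rewrite big1 // => i ij; rewrite hornerM hornerXsubC hornerC mulfV //.
    by rewrite subr_eq0 (inj_eq s_inj) eq_sym.
  rewrite (bigD1 k) 1?eq_sym //= hornerM hornerXsubC subrr mul0r.
  by rewrite mul0r.
(* [Q] has degree at most n and vanishes at n + 1 distinct nodes. *)
have sQ : (size Q <= n.+1)%N.
  apply: (leq_trans (size_polyD _ _)); rewrite geq_max size_polyN size_poly1.
  rewrite andbT; apply: (leq_trans (size_sum _ _ _)).
  apply/bigmax_leqP => j _; rewrite /L big_split /=.
  rewrite -rmorph_prod /= mulrC mul_polyC.
  apply: (leq_trans (size_scale_leq _ _)).
  rewrite (leq_trans (size_prod_leq _ _)) //.
  rewrite (eq_bigr (fun=> 2%N)); last by move=> i _; rewrite size_XsubC.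
  by rewrite sum_nat_const cardC1 card_ord /= muln2 -addnn subSn ?addnK ?leq_addr.
have Q0 : Q = 0.
  apply/eqP/negPn/negP => Q0.
  have := @max_poly_roots _ Q [seq s k | k <- enum 'I_n.+1] Q0.
  rewrite size_map size_enum_ord map_inj_uniq ?enum_uniq // ltnNge sQ /=.
  move=> h; suff: false by []; apply: h => //; apply/allP => _ /mapP[k _ ->].
  rewrite /root hornerD hornerN hornerC horner_sum (bigD1 k) //= Lk eqxx.
  by rewrite big1 ?addr0 ?subrr // => j jk; rewrite Lk (negPf jk).
have /eqP: Q.[0] = 0 by rewrite Q0 horner0.
rewrite hornerD hornerN hornerC horner_sum subr_eq0 => /eqP L1.
rewrite -[LHS]mulr1 -[X in _ * X]L1 mulr_sumr; apply: eq_bigr => j _.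
rewrite (bigD1 j) //= -mulrA; congr (_ * _).
rewrite horner_prod -big_split /=; apply: eq_bigr => i ij.
rewrite hornerM hornerXsubC hornerC sub0r -[s j - s i]opprB invrN mulrNN.
by rewrite mulKf.
Qed.

(** * Additivity of cone weights *)

Section SimplicialCones.
Context {R : realFieldType}.

(* The integral of exp (- u x) over the cone {x | M x >= 0}: if the columns of F = M^-1
   are the generators f_j of the cone, it equals |det F| / prod_j (u f_j). *)
Definition cone_weight n (M : 'M[R]_n) (u : 'rV[R]_n) : R :=
  (`|\det M| * \prod_j (u *m invmx M) 0 j)^-1.

(** Boolean, to serve as the indicator function of an open cone; boundaries are irrelevant since
    relations are tested off finitely many hyperplanes. *)
Definition pos_on n (B : seq 'rV[R]_n) (x : 'cV[R]_n) : bool :=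
  all (fun b : 'rV[R]_n => 0 < (b *m x) 0 0) B.

Definition mxrows n (M : 'M[R]_n) : seq 'rV[R]_n := [seq row j M | j <- enum 'I_n].

Definition has_line n (B : seq 'rV[R]_n) : Prop :=
  exists2 y : 'cV[R]_n, y != 0 & forall b, b \in B -> b *m y = 0.

Lemma pos_on_mxrows n (M : 'M[R]_n) x :
  pos_on (mxrows M) x = [forall j, 0 < (M *m x) j 0].
Proof.
rewrite /pos_on /mxrows all_map; apply/allP/forallP => /= h j.
  by have := h j; rewrite mem_enum -row_mul mxE; apply.
by move=> _; rewrite -row_mul mxE.
Qed.

(** Let f_j be the columns of M^-1 and b its row 0. Then [row' j (col' 0 M)] describes the
    projection of the cone along f_j to the hyperplane x_0 = 0. Its generators are f_k - (b_k / b_j)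
    f_j for k != j, and its determinant is, up to sign, a cofactor of M. *)
Lemma cone_weight_expand n (M : 'M[R]_n.+1) (u : 'rV[R]_n.+1) :
    M \in unitmx ->
    (forall j, (u *m invmx M) 0 j != 0) -> (forall j, invmx M 0 j != 0) ->
    (forall i j, i != j -> (u *m invmx M) 0 i * invmx M 0 j !=
                           (u *m invmx M) 0 j * invmx M 0 i) ->
  forall j,
  [/\ row' j (col' 0 M) \in unitmx,
      (forall k, (col' 0 u *m invmx (row' j (col' 0 M))) 0 k != 0),
      (forall k, (col' 0 u *m invmx (row' j (col' 0 M))) 0 k =
        (u *m invmx M) 0 (lift j k) -
        (u *m invmx M) 0 j / invmx M 0 j * invmx M 0 (lift j k))
    & `|\det (row' j (col' 0 M))| = `|invmx M 0 j| * `|\det M|].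
Proof.
move=> uM p0 b0 pb j; set p := u *m invmx M in p0 pb *.
have dM : \det M != 0 by rewrite -unitfE -unitmxE.
have dN : `|\det (row' j (col' 0 M))| = `|invmx M 0 j| * `|\det M|.
  rewrite /invmx uM 2!mxE /cofactor normrM normrM normfV normrX normrN1 expr1n.
  by rewrite mul1r mulrAC mulVf ?mul1r // normr_eq0.
have uN : row' j (col' 0 M) \in unitmx.
  by rewrite unitmxE unitfE -normr_eq0 dN mulf_neq0 ?normr_eq0.
pose q : 'rV[R]_n := \row_k (p 0 (lift j k) - p 0 j / invmx M 0 j * invmx M 0 (lift j k)).
have qE : col' 0 u *m invmx (row' j (col' 0 M)) = q.
  apply: (canLR (mulmxK uN)); apply/rowP => k.
  have u_ : u = p *m M by rewrite mulmxKV.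
  (* For z != 0 the identity M^-1 M = 1 gives sum_i b_i M_iz = 0, which eliminates row j. *)
  have e_ : row 0 (1%:M : 'M[R]_n.+1) = row 0 (invmx M) *m M.
    by rewrite -row_mul mulVmx.
  have := congr1 (fun A : 'rV_n.+1 => A 0 (lift 0 k)) e_.
  rewrite !mxE /= (bigD1_ord j) //= mulr0n mxE => /esym/eqP.
  rewrite addr_eq0 => /eqP bE.
  transitivity ((p *m M) 0 (lift 0 k)); first by rewrite -u_ ?mxE.
  rewrite [LHS]mxE (bigD1_ord j) //=.
  set z := lift 0 k.
  have -> : p 0 j * M j z = p 0 j / invmx M 0 j * (invmx M 0 j * M j z).
    by rewrite mulrA divfK.
  rewrite bE mulrN mulr_sumr -sumrN -big_split /=.
  by apply: eq_bigr => i _; rewrite !mxE; ring.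
split=> // k; rewrite qE mxE // subr_eq0.
apply: contraTneq (pb _ _ (neq_lift j k)) => ->.
by rewrite negbK mulrAC divfK.
Qed.

(* For fixed u, cone_weight M (u + t e_0) is a rational function of t that vanishes at
   infinity; this is its partial fraction decomposition, evaluated at t = 0. *)
Lemma cone_weight_recl n (M : 'M[R]_n.+1) (u : 'rV[R]_n.+1) :
    M \in unitmx ->
    (forall j, (u *m invmx M) 0 j != 0) -> (forall j, invmx M 0 j != 0) ->
    (forall i j, i != j -> (u *m invmx M) 0 i * invmx M 0 j !=
                           (u *m invmx M) 0 j * invmx M 0 i) ->
  cone_weight M u = \sum_j Num.sg (invmx M 0 j) *
     ((u *m invmx M) 0 j / invmx M 0 j)^-1 *
     cone_weight (row' j (col' 0 M)) (col' 0 u).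
Proof.
move=> uM p0 b0 pb; have ex := cone_weight_expand uM p0 b0 pb.
rewrite /cone_weight; set p := u *m invmx M in p0 pb ex *.
(* The pairing of u + t e_0 with the generator j is b_j (t + s_j), so the poles are the -s_j; they
   are distinct by [pb]. *)
pose b j := invmx M 0 j; pose s j := p 0 j / b j.
have s0 j : s j != 0 by rewrite mulf_neq0 // invr_eq0; apply: b0.
have s_inj : injective s.
  move=> i j /eqP; rewrite /s eqr_div ?b0 // => ij; apply/eqP.
  by apply: contraTT ij => /pb.
have pE : \prod_j p 0 j = \prod_j s j * \prod_j b j.
  by rewrite -big_split; apply: eq_bigr => j _; rewrite /= divfK ?b0.
rewrite pE invfM mulrC invfM -prodfV prod_partial_fraction // !mulr_suml.
apply: eq_bigr => j _; have [_ _ qE ->] := ex j.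
under [in RHS]eq_bigr do rewrite qE.
have liftE (f : 'I_n.+1 -> R) : \prod_(i | i != j) f i = \prod_k f (lift j k).
  rewrite big_mkcond (bigD1_ord j) //= eqxx mul1r.
  by apply: eq_bigr => k _; rewrite eq_sym neq_lift.
rewrite liftE (bigD1_ord j (F := b)) //= -/(b j) -/(s j).
have -> : \prod_i (p 0 (lift j i) - s j * invmx M 0 (lift j i)) =
          \prod_i (s (lift j i) - s j) * \prod_i b (lift j i).
  by rewrite -big_split; apply: eq_bigr => i _; rewrite /= mulrBl divfK ?b0.
rewrite prodfV.
have bj : b j != 0 by apply: b0.
(* The sign arises because the determinant of the quotient contains |b_j| and the residue b_j. *)
have -> : Num.sg (b j) = `|b j| / b j by rewrite normrEsg mulfK.
have nb : `|b j| != 0 by rewrite normr_eq0.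
have d0 : `|\det M| != 0 by rewrite normr_eq0 -unitfE -unitmxE.
have B0 : \prod_i b (lift j i) != 0 by apply/prodf_neq0 => i _; apply: b0.
have A0 : \prod_i (s (lift j i) - s j) != 0.
  apply/prodf_neq0 => i _; rewrite subr_eq0 (inj_eq s_inj) eq_sym.
  exact: neq_lift.
by field; rewrite (s0 j) A0 B0 d0 bj nb.
Qed.

(** * Cones at the two ends of a line *)

(** One plus the sum of the ratios |s x| / |s w| exceeds each of them. For such t, a form not
    vanishing at w has at x + t w the sign of its value at w. *)
Lemma exists_far n (S : seq 'rV[R]_n) (x w : 'cV[R]_n) :
  exists t, forall s, s \in S -> (s *m w) 0 0 != 0 ->
    `|(s *m x) 0 0| < t * `|(s *m w) 0 0|.
Proof.
pose f (s : 'rV[R]_n) := `|(s *m x) 0 0| / `|(s *m w) 0 0|.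
exists (1 + \sum_(s <- S) f s) => s sS sw0.
rewrite -ltr_pdivrMr ?normr_gt0 // -/(f s) (big_rem s) //=.
have : 0 <= \sum_(y <- rem s S) f y by apply: sumr_ge0 => y _; rewrite divr_ge0.
lra.
Qed.

Lemma pos_on_far n (B : seq 'rV[R]_n) (x w : 'cV[R]_n) t :
    (forall b, b \in B -> (b *m w) 0 0 != 0 ->
       `|(b *m x) 0 0| < t * `|(b *m w) 0 0|) ->
  pos_on B (x + t *: w) =
  all (fun b : 'rV[R]_n => 0 <= (b *m w) 0 0) B &&
  pos_on [seq b <- B | (b *m w) 0 0 == 0] x.
Proof.
move=> far; rewrite /pos_on all_filter -all_predI.
apply: eq_in_all => b bB /=; have := far b bB.
have -> : (b *m (x + t *: w)) 0 0 = (b *m x) 0 0 + t * (b *m w) 0 0.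
  by rewrite mulmxDr -scalemxAr mxE [X in _ + X]mxE.
case: (ltrgt0P ((b *m w) 0 0)) => [w0|w0|w0] /=; last first.
- by rewrite w0 mulr0 addr0.
- move=> /(_ isT); rewrite ltr_norml => /andP[_ h].
  by apply/negbTE; rewrite -leNgt; lra.
by move=> /(_ isT); rewrite ltr_norml => /andP[+ _]; lra.
Qed.

(* Between the two ends of the line through lift0v x directed by w, pos_on B jumps by
   jump_sign B w * pos_on (link B w) x, see pos_on_jump. *)
Definition jump_sign n (B : seq 'rV[R]_n) (w : 'cV[R]_n) : R :=
  (all (fun b : 'rV[R]_n => 0 <= (b *m w) 0 0) B)%:R -
  (all (fun b : 'rV[R]_n => (b *m w) 0 0 <= 0) B)%:R.

(** The forms vanishing at w descend to the quotient by w. For w_0 = 1 the hyperplane x_0 = 0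
    represents this quotient, hence the restriction by [col' 0]. *)
Definition link n (B : seq 'rV[R]_n.+1) (w : 'cV[R]_n.+1) : seq 'rV[R]_n :=
  [seq col' 0 b | b : 'rV[R]_n.+1 <- B & (b *m w) 0 0 == 0].

Definition lift0v n (x : 'cV[R]_n) : 'cV[R]_n.+1 :=
  \col_i (if unlift 0 i is Some k then x k 0 else 0).

Lemma mulmx_lift0v n (b : 'rV[R]_n.+1) (x : 'cV[R]_n) :
  b *m lift0v x = col' 0 b *m x.
Proof.
apply/matrixP => i j; rewrite !ord1 !mxE big_ord_recl mxE unlift_none mulr0 add0r.
by apply: eq_bigr => k _; rewrite !mxE liftK.
Qed.

Lemma pos_on_jump n (B : seq 'rV[R]_n.+1) (x : 'cV[R]_n) (w : 'cV[R]_n.+1) t :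
    (forall b, b \in B -> (b *m w) 0 0 != 0 ->
       `|(b *m lift0v x) 0 0| < t * `|(b *m w) 0 0|) ->
  (pos_on B (lift0v x + t *: w))%:R - (pos_on B (lift0v x - t *: w))%:R =
  jump_sign B w * (pos_on (link B w) x)%:R :> R.
Proof.
move=> far; rewrite -scalerN !pos_on_far //; last first.
  by move=> b bB; rewrite mulmxN mxE oppr_eq0 normrN; apply: far.
have lE : pos_on (link B w) x = pos_on [seq b <- B | (b *m w) 0 0 == 0] (lift0v x).
  rewrite /pos_on /link all_map; apply: eq_all => b /=.
  by rewrite mulmx_lift0v.
have -> : [seq b <- B | (b *m - w) 0 0 == 0] = [seq b <- B | (b *m w) 0 0 == 0].
  by apply: eq_filter => b; rewrite mulmxN mxE oppr_eq0.
have -> : all (fun b : 'rV[R]_n.+1 => 0 <= (b *m - w) 0 0) B =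
          all (fun b : 'rV[R]_n.+1 => (b *m w) 0 0 <= 0) B.
  by apply: eq_all => b; rewrite mulmxN mxE oppr_ge0.
by rewrite lE -!mulnb !natrM -mulrBl.
Qed.

Lemma lift0v_row' n (y : 'cV[R]_n.+1) : y 0 0 = 0 -> y = lift0v (row' 0 y).
Proof.
move=> y0; apply/colP => i; rewrite !mxE.
by case: unliftP => [k|] ->; rewrite // !mxE.
Qed.

(** The projection y - y_0 w of y along w lies in the hyperplane x_0 = 0 and is nonzero, y not being
    a multiple of w. *)
Lemma has_line_link n (B : seq 'rV[R]_n.+1) (w y : 'cV[R]_n.+1) :
    w 0 0 = 1 -> (forall c, y != c *: w) ->
    (forall b, b \in B -> (b *m w) 0 0 = 0 -> b *m y = 0) ->
  has_line (link B w).
Proof.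
move=> w0 yw By; pose z := y - y 0 0 *: w.
have z0 : z 0 0 = 0 by rewrite !mxE w0 mulr1 subrr.
exists (row' 0 z).
  apply: contraNneq (yw (y 0 0)) => z'0; rewrite -subr_eq0 -/z (lift0v_row' z0) z'0.
  by apply/eqP/colP => i; rewrite !mxE; case: unlift => // k; rewrite mxE.
move=> _ /mapP[b + ->]; rewrite mem_filter => /andP[/eqP bw bB].
rewrite -mulmx_lift0v -lift0v_row' // mulmxBr -scalemxAr By // [b *m w]mx11_scalar bw.
by rewrite raddf0 scaler0 subr0.
Qed.

(** If the line is parallel to w, all forms vanish at w and both ends agree; otherwise the line
    survives in the quotient. *)
Lemma has_line_link_or n (B : seq 'rV[R]_n.+1) (w : 'cV[R]_n.+1) :
  w 0 0 = 1 -> has_line B -> jump_sign B w = 0 \/ has_line (link B w).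
Proof.
move=> w0 [y y0 By]; have [[c yE]|nc] := pselect (exists c, y = c *: w).
  left; have c0 : c != 0 by apply: contraNneq y0 => c0; rewrite yE c0 scale0r.
  have Bw b : b \in B -> (b *m w) 0 0 = 0.
    move=> /By/eqP; rewrite yE -scalemxAr scaler_eq0 (negPf c0) => /eqP ->.
    by rewrite mxE.
  rewrite /jump_sign !(eq_in_all (a2 := predT)) ?all_predT ?subrr // => b /Bw ->;
  by rewrite lexx.
right; apply: (has_line_link w0 (y := y)) => [c|b bB _]; last exact: By.
by apply/eqP => yE; apply: nc; exists c.
Qed.

(** At the rescaled generator w all facet forms vanish except the one of index j, which takes the
    value 1 / b_j. *)
Lemma link_simplicial n (M : 'M[R]_n.+1) (w : 'cV[R]_n.+1) j :
    M \in unitmx -> invmx M 0 j != 0 ->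
    w = (invmx M 0 j)^-1 *: col j (invmx M) ->
  jump_sign (mxrows M) w = Num.sg (invmx M 0 j) /\
  forall x, pos_on (link (mxrows M) w) x = pos_on (mxrows (row' j (col' 0 M))) x.
Proof.
move=> uM b0 wE; set b := invmx M 0 j in b0 wE *.
have Mw i : (row i M *m w) 0 0 = (i == j)%:R / b.
  by rewrite wE -scalemxAr mxE -row_mul colE mulKVmx // !mxE andbT mulrC.
have Mwj : (row j M *m w) 0 0 = b^-1 by rewrite Mw eqxx mul1r.
have Mwi i : i != j -> (row i M *m w) 0 0 = 0.
  by move=> ij; rewrite Mw (negPf ij) mul0r.
split=> [|x].
  have aE (P : pred R) : P 0 ->
      all (fun a : 'rV[R]_n.+1 => P ((a *m w) 0 0)) (mxrows M) = P b^-1.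
    move=> P0; rewrite /mxrows all_map; apply/allP/idP => /= [/(_ j)|Pb i _].
      by rewrite mem_enum Mwj; apply.
    by have [->|ij] := eqVneq i j; rewrite ?Mwj ?Mwi.
  rewrite /jump_sign (aE (fun y => 0 <= y)) ?(aE (fun y => y <= 0)) //.
  rewrite invr_ge0 invr_le0; case: (ltrgt0P b) b0 => // [b_gt0|b_lt0] _.
    by rewrite gtr0_sg // subr0.
  by rewrite ltr0_sg // sub0r.
rewrite pos_on_mxrows /pos_on /link all_map all_filter /mxrows all_map.
have colE i : (col' 0 (row i M) *m x) 0 0 = (col' 0 M *m x) i 0.
  by rewrite !mxE; apply: eq_bigr => k _; rewrite !mxE.
apply/allP/forallP => [h k|h i _] /=.
  have /= := h (lift j k); rewrite mem_enum Mwi 1?eq_sym ?neq_lift // eqxx /=.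
  by rewrite colE => /(_ isT); rewrite !mxE; under eq_bigr do rewrite !mxE;
     under [X in _ -> is_true (_ < X)]eq_bigr do rewrite !mxE.
have [->|ij] := eqVneq i j; first by rewrite Mwj invr_eq0 (negPf b0).
rewrite Mwi // eqxx /= colE.
have [k ik|ik] := unliftP j i; last by rewrite ik eqxx in ij.
have := h k; rewrite ik !mxE; under eq_bigr do rewrite !mxE.
by under [X in _ -> is_true (_ < X)]eq_bigr do rewrite !mxE.
Qed.

(** As w is not proportional to a generator, two facet forms i and j are nonzero at w. The generator
    f_j is annihilated by all facet forms but j, hence by those vanishing at w, and form i shows
    that it is not a multiple of w. *)
Lemma has_line_link_nonsimplicial n (M : 'M[R]_n.+1) (w : 'cV[R]_n.+1) :
    M \in unitmx -> w 0 0 = 1 ->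
    (forall j, w != (invmx M 0 j)^-1 *: col j (invmx M)) ->
  has_line (link (mxrows M) w).
Proof.
move=> uM w0 wj.
have rowM i : (row i M *m w) 0 0 = (M *m w) i 0 by rewrite -row_mul mxE.
have [j Mwj] : exists j, (M *m w) j 0 != 0.
  apply/existsP; rewrite -negb_forall; apply: contra_eqN w0 => /forallP h.
  have -> : w = 0; last by rewrite mxE eq_sym oner_eq0.
  rewrite -[w](mulKmx uM); suff -> : M *m w = 0 by rewrite mulmx0.
  by apply/colP => i; have /eqP -> := h i; rewrite mxE.
have [i ij Mwi] : exists2 i, i != j & (M *m w) i 0 != 0.
  apply/exists_inP; rewrite -negb_forall_in; apply: contraNN (wj j) => /forall_inP h.
  have Mw : M *m w = (M *m w) j 0 *: delta_mx j 0.
    apply/colP => k; rewrite [RHS]mxE [X in _ * X]mxE andbT.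
    have [->|/h/eqP ->] := eqVneq k j; by rewrite ?mulr1 ?mulr0.
  have wE : w = (M *m w) j 0 *: col j (invmx M).
    by rewrite -[LHS](mulKmx uM) {1}Mw -scalemxAr colE.
  have : w 0 0 = (M *m w) j 0 * invmx M 0 j by rewrite {1}wE !mxE.
  rewrite w0 => c1; rewrite {1}wE; apply/eqP; congr (_ *: _).
  have b0 : invmx M 0 j != 0 by apply: contra_eq_neq c1 => ->; rewrite mulr0 oner_eq0.
  by apply: (mulIf b0); rewrite -c1 mulVf.
apply: (@has_line_link _ _ _ (col j (invmx M))) => // [c|b].
  apply/eqP => /(congr1 (mulmx M)); rewrite colE mulKVmx // -scalemxAr => /colP e.
  have /esym/eqP : 0 = c * (M *m w) i 0 by have := e i; rewrite !mxE (negPf ij).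
  rewrite mulf_eq0 (negPf Mwi) orbF => /eqP c0.
  by have /eqP := e j; rewrite c0 scale0r !mxE !eqxx oner_eq0.
move=> /mapP[k _ ->]; rewrite rowM => Mwk; apply/rowP => l.
rewrite ord1 -row_mul colE mulKVmx // !mxE andbT; have [kj|//] := eqVneq k j.
by rewrite kj in Mwk; rewrite Mwk eqxx in Mwj.
Qed.

(** * From relations between indicator functions to relations between weights *)

Lemma sum_fibers_eq0 (Q : finType) (T : eqType) (W : Q -> T) (f : Q -> R) :
  (forall w, \sum_(q | W q == w) f q = 0) -> \sum_q f q = 0.
Proof.
move=> f0; transitivity (\sum_q \sum_(w <- undup (codom W) | w == W q) f q).
  apply: eq_bigr => q _; rewrite -big_filter.
  by rewrite (filter_pred1_uniq (undup_uniq _)) ?big_seq1 // mem_undup codom_f.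
rewrite (exchange_big_dep xpredT) //= big1 // => w _.
by rewrite -[RHS](f0 w); apply: eq_bigl => q; rewrite eq_sym.
Qed.

(* An identity between indicator functions of simplicial cones, modulo cones that
   contain a line, valid off the hyperplanes with normals in H. *)
Definition cone_relation n (I J : finType) (c : I -> R) (M : I -> 'M[R]_n)
    (d : J -> R) (B : J -> seq 'rV[R]_n) (H : seq 'rV[R]_n) : Prop :=
  forall x : 'cV[R]_n, (forall h, h \in H -> (h *m x) 0 0 != 0) ->
    \sum_i c i * (pos_on (mxrows (M i)) x)%:R +
    \sum_k d k * (pos_on (B k) x)%:R = 0.

(** Cones with a line are carried along because they arise as links in the induction; they leave no
    trace in the conclusion. The alternative [d k = 0] lets terms be discarded without changing the
    index type. *)
Definition weight_relation n : Prop :=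
  forall (I J : finType) (c : I -> R) (M : I -> 'M[R]_n)
    (d : J -> R) (B : J -> seq 'rV[R]_n) (H : seq 'rV[R]_n) (u : 'rV[R]_n),
  (forall i, M i \in unitmx) ->
  (forall i j, (u *m invmx (M i)) 0 j != 0) ->
  (forall k, d k = 0 \/ has_line (B k)) ->
  (forall h, h \in H -> h != 0) ->
  cone_relation c M d B H -> \sum_i c i * cone_weight (M i) u = 0.

(** Space is a point: every simplicial cone contains it and has weight 1, and no cone contains a
    line. *)
Lemma weight_relation0 : weight_relation 0.
Proof.
move=> I J c M d B H u _ _ dB H0 rel.
have d0 k : d k = 0 by case: (dB k) => // -[y]; rewrite [y]flatmx0 eqxx.
have /rel : forall h, h \in H -> (h *m (0 : 'cV[R]_0)) 0 0 != 0.
  by move=> h /H0; rewrite [h]thinmx0 eqxx.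
rewrite [X in _ + X]big1 ?addr0 => [|k _]; last by rewrite d0 mul0r.
move=> rel0; rewrite -[RHS]rel0; apply: eq_bigr => i _; congr (_ * _).
rewrite pos_on_mxrows /cone_weight det_mx00 big_ord0 normr1 mulr1 invr1.
by case: forallP => // -[] [].
Qed.

(** Weights are expanded by partial fractions and the terms grouped by the direction w of the
    generator. Each group has the common factor 1 / (u w), and the remaining sum vanishes by
    induction applied to the jumps along w. *)
Lemma weight_relation_generic n (I J : finType) (c : I -> R) (M : I -> 'M[R]_n.+1)
    (d : J -> R) (B : J -> seq 'rV[R]_n.+1) (H : seq 'rV[R]_n.+1) (u : 'rV[R]_n.+1) :
  weight_relation n ->
  (forall i, M i \in unitmx) ->
  (forall i j, (u *m invmx (M i)) 0 j != 0) ->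
  (forall k, d k = 0 \/ has_line (B k)) ->
  (forall h, h \in H -> h != 0) ->
  cone_relation c M d B H ->
  (forall i j, invmx (M i) 0 j != 0) ->
  (forall l i j, i != j -> (u *m invmx (M l)) 0 i * invmx (M l) 0 j !=
                           (u *m invmx (M l)) 0 j * invmx (M l) 0 i) ->
  \sum_i c i * cone_weight (M i) u = 0.
Proof.
move=> IH uM p0 dB H0 rel b0 pb.
(* Scaling generators to first coordinate 1 makes proportional ones from different cones equal. *)
pose W (q : I * 'I_n.+1) := (invmx (M q.1) 0 q.2)^-1 *: col q.2 (invmx (M q.1)).
have W0 q : W q 0 0 = 1 by rewrite !mxE mulVf.
have uW q : (u *m W q) 0 0 = (u *m invmx (M q.1)) 0 q.2 / invmx (M q.1) 0 q.2.
  by rewrite -scalemxAr mxE mulrC colE mulmxA -colE mxE.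
pose c1 (q : I * 'I_n.+1) := c q.1 * Num.sg (invmx (M q.1) 0 q.2).
pose M1 (q : I * 'I_n.+1) := row' q.2 (col' 0 (M q.1)).
transitivity (\sum_q c1 q * ((u *m W q) 0 0)^-1 * cone_weight (M1 q) (col' 0 u)).
  rewrite -(pair_bigA _ (fun i j => c1 (i, j) * ((u *m W (i, j)) 0 0)^-1 *
                                    cone_weight (M1 (i, j)) (col' 0 u))) /=.
  apply: eq_bigr => i _; rewrite cone_weight_recl //; last exact: pb.
  by rewrite mulr_sumr; apply: eq_bigr => j _; rewrite uW /= !mulrA.
apply: (sum_fibers_eq0 (W := W)) => w.
have [q0 /eqP Wq0|Wn] := pickP (fun q => W q == w); last by rewrite big_pred0.
have w0 : w 0 0 = 1 by rewrite -Wq0.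
transitivity (((u *m w) 0 0)^-1 *
    \sum_q (if W q == w then c1 q else 0) * cone_weight (M1 q) (col' 0 u)).
  rewrite mulr_sumr big_mkcond; apply: eq_bigr => q _.
  by have [->|_] := eqVneq (W q) w; rewrite ?mul0r ?mulr0 // mulrCA mulrA.
have ex q := cone_weight_expand (uM q.1) (p0 q.1) (b0 q.1) (pb q.1) q.2.
(* Cones with a generator along w stay on the simplicial side, so they get coefficient 0 here; the
   links of all others contain a line or have jump 0. *)
pose d1 (s : I + J) := match s with
  | inl i => if [exists j, W (i, j) == w] then 0 else c i * jump_sign (mxrows (M i)) w
  | inr k => d k * jump_sign (B k) w end.
pose B1 (s : I + J) := match s with
  | inl i => link (mxrows (M i)) w | inr k => link (B k) w end.
rewrite (IH _ _ _ _ d1 B1 (link H w)) ?mulr0 //.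
- by move=> q; have [] := ex q.
- by move=> q; have [] := ex q.
- move=> [i|k] /=.
    case: ifPn => [_|]; [by left|rewrite negb_exists => /forallP nW; right].
    apply: has_line_link_nonsimplicial => // j.
    by rewrite eq_sym; apply: nW.
  case: (dB k) => [->|/(has_line_link_or w0)[->|]]; last by right.
    by left; rewrite mul0r.
  by left; rewrite mulr0.
- move=> _ /mapP[h + ->]; rewrite mem_filter => /andP[/eqP hw hH].
  apply: contraNneq (H0 _ hH) => h'0; apply/eqP/rowP => i; rewrite mxE.
  have h' k : h 0 (lift 0 k) = 0 by have /rowP/(_ k) := h'0; rewrite !mxE.
  have [k|] := unliftP 0 i => ->; first exact: h'.
  move: hw; rewrite mxE big_ord_recl w0 mulr1 big1 ?addr0 // => k _.
  by rewrite h' mul0r.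
move=> x xH.
pose S := H ++ flatten [seq mxrows (M i) | i <- enum I] ++ flatten [seq B k | k <- enum J].
have [t far] := exists_far S (lift0v x) w.
(* Both ends avoid the hyperplanes of H: forms vanishing at w are controlled by the choice of x, the
   others by the size of t. *)
have gen e : `|e| = 1 -> forall h, h \in H -> (h *m (lift0v x + (e * t) *: w)) 0 0 != 0.
  move=> e1 h hH.
  have -> : (h *m (lift0v x + (e * t) *: w)) 0 0 =
            (h *m lift0v x) 0 0 + e * t * (h *m w) 0 0.
    by rewrite mulmxDr -scalemxAr mxE [X in _ + X]mxE.
  have [hw|hw] := eqVneq ((h *m w) 0 0) 0.
    rewrite hw mulr0 addr0 mulmx_lift0v; apply: xH.
    by apply: map_f; rewrite mem_filter hw eqxx.
  have := far h; rewrite mem_cat hH => /(_ isT hw) lt; apply/eqP => /eqP.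
  rewrite addr_eq0 => /eqP hx; move: lt.
  rewrite hx normrN !normrM e1 mul1r ltNge ler_wpM2r // ler_norm //.
have := rel _ (gen 1 (normr1 _)); have := rel _ (gen (-1) (normrN1 _)).
rewrite mul1r mulN1r scaleNr => rel1 rel2.
(* Subtracting the relations at the two ends leaves a relation between the jumps. *)
have {rel1 rel2} : \sum_i c i * (jump_sign (mxrows (M i)) w * (pos_on (link (mxrows (M i)) w) x)%:R) +
   \sum_k d k * (jump_sign (B k) w * (pos_on (link (B k) w) x)%:R) = 0.
  have := etrans (congr2 (fun a b => a - b) rel2 rel1) (subrr 0).
  rewrite /= opprD addrACA -!sumrB => rel12; rewrite -[RHS]rel12.
  congr (_ + _); apply: eq_bigr => i _; rewrite -mulrBr -(pos_on_jump (t := t)) // => b bB;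
    apply: far; rewrite !mem_cat; apply/or3P; [apply: Or32|apply: Or33];
    by apply/flatten_mapP; exists i; rewrite ?mem_enum.
move=> jrel; rewrite -[RHS]jrel big_sumType /= addrA; congr (_ + _); last first.
  by apply: eq_bigr => k _; rewrite mulrA.
rewrite -(pair_bigA _ (fun i j => (if W (i, j) == w then c1 (i, j) else 0) *
                                  (pos_on (mxrows (M1 (i, j))) x)%:R)) /=.
rewrite -big_split; apply: eq_bigr => i _ /=.
case: ifPn => [/existsP[j /eqP Wj]|]; last first.
  rewrite negb_exists => /forallP nW; rewrite big1 ?add0r ?mulrA // => j _.
  by rewrite (negPf (nW j)) mul0r.
have [-> ->] := link_simplicial (uM i) (b0 i j) (esym Wj).
(* The generators of a cone are independent, so only j points along w. *)
rewrite mul0r addr0 (bigD1 j) //= Wj eqxx big1 ?addr0 ?mulrA // => k kj.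
case: eqP => [|_]; last by rewrite mul0r.
rewrite -Wj /W /= => /(congr1 (mulmx (M i))).
rewrite -!scalemxAr !colE !mulKVmx // => /colP/(_ k)/eqP.
by rewrite !mxE eqxx (negPf kj) mulr0 mulr1 invr_eq0 (negPf (b0 i k)).
Qed.

(** * Reduction to generic coordinates *)

Lemma invmx_mul n (A B : 'M[R]_n) : A \in unitmx -> B \in unitmx ->
  invmx (A *m B) = invmx B *m invmx A.
Proof.
move=> uA uB; have uAB : A *m B \in unitmx by rewrite unitmx_mul uA.
by rewrite -[RHS](mulKmx uAB) -mulmxA (mulKVmx uB) mulmxV // mulmx1.
Qed.

Lemma row0_scaled_unitmx n (xi : 'rV[R]_n.+1) : xi != 0 ->
  exists2 N : 'M[R]_n.+1, N \in unitmx & exists2 l, l != 0 & xi = l *: row 0 N.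
Proof.
move=> xi0; exists (row_ebase xi); first exact: row_ebase_unit.
have xiE : xi = col_ebase xi 0 0 *: row 0 (row_ebase xi).
  rewrite -{1}(mulmx_ebase xi) rank_rV xi0 {1}[col_ebase xi]mx11_scalar -mulmxA.
  rewrite mul_scalar_mx rowE; congr (_ *: (_ *m _)).
  by apply/matrixP => i j; rewrite !mxE !ord1 /= andbT eq_sym.
exists (col_ebase xi 0 0) => //.
by apply: contraNneq xi0 => l0; rewrite xiE l0 scale0r.
Qed.

(** Genericity of coordinate 0 is reached by a change of coordinates N whose first row is
    proportional to a generic form [xi]; all weights get multiplied by |det N|. *)
Lemma cone_relation_simplicial n : weight_relation n.
Proof.
elim: n => [|n IH]; first exact: weight_relation0.
move=> I J c M d B H u uM p0 dB H0 rel.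
pose p l j := (u *m invmx (M l)) 0 j.
(* [xi] must not vanish on the generators f_j (case i = j) nor on p_i f_j - p_j f_i, which separates
   the poles of each cone. The first entry ensures [xi] != 0 even for empty I. *)
pose C := (delta_mx 0 0 : 'cV[R]_n.+1) ::
  [seq (let: (l, i, j) := q in if i == j then col j (invmx (M l)) else
      p l i *: col j (invmx (M l)) - p l j *: col i (invmx (M l)))
    | q <- enum ((I * 'I_n.+1 * 'I_n.+1)%type : finType)].
have McolM l j : M l *m col j (invmx (M l)) = delta_mx j 0.
  by rewrite colE mulKVmx.
have [|xi xiC] := @exists_nonorthogonal _ _ C.
  move=> v; rewrite inE => /orP[/eqP ->|/mapP[[[l i] j] _ ->]].
    by apply/eqP => /matrixP/(_ 0 0)/eqP; rewrite !mxE eqxx oner_eq0.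
  case: (i =P j) => [_|/eqP ij]; apply/eqP => /(congr1 (mulmx (M l))).
    rewrite McolM mulmx0 => /matrixP/(_ j 0)/eqP.
    by rewrite !mxE !eqxx oner_eq0.
  rewrite mulmxBr -!scalemxAr !McolM mulmx0 => /matrixP/(_ j 0)/eqP.
  rewrite !mxE !eqxx [j == i]eq_sym (negPf ij) mulr0 subr0 mulr1.
  exact/negP/p0.
have xi0 : xi != 0.
  by apply: contraNneq (xiC _ (mem_head _ _)) => ->; rewrite mul0mx mxE.
have [N uN [l0 l00 xiE]] := row0_scaled_unitmx xi0.
have xi_inv l j : (xi *m col j (invmx (M l))) 0 0 = l0 * (N *m invmx (M l)) 0 j.
  by rewrite colE mulmxA -colE mxE xiE -scalemxAl mxE -row_mul mxE.
have q0 l i j : (xi *m (if i == j then col j (invmx (M l)) else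
      p l i *: col j (invmx (M l)) - p l j *: col i (invmx (M l)))) 0 0 != 0.
  by apply: xiC; rewrite inE; apply/orP; right; apply/mapP; exists (l, i, j); rewrite ?mem_enum.
have uN' : invmx N \in unitmx by rewrite unitmx_inv.
have invMN l : invmx (M l *m invmx N) = N *m invmx (M l).
  by rewrite invmx_mul // invmxK.
have pN l : u *m invmx N *m invmx (M l *m invmx N) = u *m invmx (M l).
  by rewrite invMN mulmxA mulmxKV.
have rowsN l : mxrows (M l *m invmx N) = [seq b *m invmx N | b <- mxrows (M l)].
  by rewrite /mxrows -[in RHS]map_comp; apply: eq_map => j /=; rewrite row_mul.
have posN (b : seq 'rV[R]_n.+1) x :
    pos_on [seq a *m invmx N | a <- b] x = pos_on b (invmx N *m x).
  by rewrite /pos_on all_map; apply: eq_all => a /=; rewrite mulmxA.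
have wN l : cone_weight (M l *m invmx N) (u *m invmx N) = `|\det N| * cone_weight (M l) u.
  rewrite /cone_weight pN det_mulmx det_inv normrM normfV !invfM invrK.
  by rewrite mulrAC mulrC mulrA.
have dN : `|\det N| != 0 by rewrite normr_eq0 -unitfE -unitmxE.
apply: (mulfI dN); rewrite mulr0 mulr_sumr.
under eq_bigr do rewrite mulrCA -wN.
apply: (@weight_relation_generic n I J c _ d (fun k => [seq b *m invmx N | b <- B k])
   [seq h *m invmx N | h <- H]) => //.
- by move=> l; rewrite unitmx_mul uM.
- by move=> l j; rewrite pN.
- move=> k; case: (dB k) => [|[y y0 By]]; [by left|right].
  exists (N *m y).
    by apply: contraNneq y0 => /(congr1 (mulmx (invmx N))); rewrite mulKmx // mulmx0 => ->.
  by move=> _ /mapP[b /By b0 ->]; rewrite mulmxA mulmxKV.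
- move=> _ /mapP[h /H0 h0 ->]; apply: contraNneq h0.
  by move=> /(congr1 (mulmxr N)) /=; rewrite mulmxKV // mul0mx => ->.
- move=> x xH; under eq_bigr do rewrite rowsN posN.
  under [X in _ + X]eq_bigr do rewrite posN.
  by apply: rel => h hH; rewrite mulmxA; apply/xH/map_f.
- move=> l j; have := q0 l j j; rewrite eqxx xi_inv mulf_eq0 negb_or l00 /=.
  by rewrite invMN.
move=> l i j ij; rewrite pN invMN -subr_eq0 -(inj_eq (mulfI l00)) mulr0 mulrBr.
rewrite mulrCA -xi_inv [X in _ - X]mulrCA -xi_inv.
have := q0 l i j; rewrite (negPf ij) mulmxBr -!scalemxAr.
by rewrite mxE [X in X + _]mxE [X in _ + X]mxE [X in - X]mxE.
Qed.

End SimplicialCones.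

(** * Triangulated cones *)

Section Triangulations.
Context {R : realType} {n : nat}.
Implicit Types (F G V : {fset 'rV[R]_n}) (T : {fset {fset 'rV[R]_n}}).
Implicit Types (A : 'M[R]_n) (x u : 'rV[R]_n).

Lemma dotvC u v : dotv u v = dotv v u :> R.
Proof. by rewrite /dotv -[u *m _]trmxK trmx_mul trmxK mxE. Qed.

Lemma dotvDr u v w : dotv u (v + w) = dotv u v + dotv u w :> R.
Proof. by rewrite /dotv linearD /= mulmxDr mxE. Qed.

Lemma dotvZr u a v : dotv u (a *: v) = a * dotv u v :> R.
Proof. by rewrite /dotv linearZ /= -scalemxAr mxE. Qed.

Lemma dotv0r u : dotv u 0 = 0 :> R.
Proof. by rewrite -(scale0r 0) dotvZr mul0r. Qed.

Lemma dotv_sumr u I (r : seq I) (f : I -> 'rV[R]_n) :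
  dotv u (\sum_(i <- r) f i) = \sum_(i <- r) dotv u (f i).
Proof. by apply: (big_morph (dotv u)) => [v w|]; [exact: dotvDr|exact: dotv0r]. Qed.

(* The facet normals of the cone generated by the rows of A. *)
Definition covmx A : 'M[R]_n := invmx A^T.

Lemma covmx_unit A : (covmx A \in unitmx) = (A \in unitmx).
Proof. by rewrite unitmx_inv unitmx_tr. Qed.

Lemma covmx_coord A x j : (row j (covmx A) *m x^T) 0 0 = (x *m invmx A) 0 j.
Proof.
by rewrite -row_mul mxE /covmx -trmx_inv -trmx_mul mxE.
Qed.

Lemma pos_on_covmx A x :
  pos_on (mxrows (covmx A)) x^T = [forall j, 0 < (x *m invmx A) 0 j].
Proof.
rewrite pos_on_mxrows; apply: eq_forallb => j.
by rewrite -covmx_coord -row_mul [in RHS]mxE.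
Qed.

Lemma cone_weight_covmx A u :
  cone_weight (covmx A) u = `|\det A| / \prod_j dotv (row j A) u.
Proof.
rewrite /cone_weight /covmx invmxK det_inv det_tr normfV invfM invrK.
congr (_ / _); apply: eq_bigr => j _.
by rewrite dotvC /dotv tr_row colE mulmxA -colE [RHS]mxE.
Qed.

Definition genmx F : 'M[R]_n := \matrix_(k < n) nth 0 F k.

Lemma basis_genmx F : basis_of fullv F -> size F = n /\ genmx F \in unitmx.
Proof.
move=> bF; have sF : size F = n.
  have := size_basis (X := in_tuple F) bF.
  by rewrite dimvf /dim /= mul1n.
split=> //; rewrite -row_free_unit; apply: inj_row_free => v vF.
have /freeP fF := basis_free bF : free (in_tuple F).
have v0 : forall i : 'I_(size F), (fun j : 'I_(size F) => v 0 (cast_ord sF j)) i = 0.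
  apply: fF; rewrite -[RHS]vF mulmx_sum_row (reindex (cast_ord sF)) /=; last first.
    by exists (cast_ord (esym sF)) => k _; rewrite ?cast_ordK ?cast_ordKV.
  by apply: eq_bigr => k _; rewrite rowK.
by apply/rowP => k; have := v0 (cast_ord (esym sF) k); rewrite /= cast_ordKV mxE.
Qed.

Lemma absdetE F : absdet F = `|\det (genmx F)|.
Proof. by []. Qed.

Lemma prod_genmx F u : size F = n ->
  \prod_j dotv (row j (genmx F)) u = \prod_(w <- F) dotv w u.
Proof.
move=> sF; rewrite (big_nth 0) big_mkord sF.
by apply: eq_bigr => j _; rewrite rowK.
Qed.

Lemma sum_genmx_coord F (c : 'rV[R]_n -> R) : size F = n -> genmx F \in unitmx ->
  (\sum_(y <- F) c y *: y) *m invmx (genmx F) = \row_j c (nth 0 F j).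
Proof.
move=> sF uF; rewrite -[RHS](mulmxK uF); congr (_ *m _).
rewrite mulmx_sum_row (big_nth 0) big_mkord sF.
by apply: eq_bigr => j _; rewrite rowK mxE.
Qed.

Lemma conic_hullP F x : size F = n -> genmx F \in unitmx ->
  conic_hull F x <-> forall j, 0 <= (x *m invmx (genmx F)) 0 j.
Proof.
move=> sF uF; split=> [[c [c0 ->]] j|x0]; first by rewrite sum_genmx_coord // mxE.
pose c y := if insub (index y F) is Some j then (x *m invmx (genmx F)) 0 j else 0.
exists c; split=> [y|]; first by rewrite /c; case: insub.
rewrite -[LHS](mulmxKV uF) mulmx_sum_row [RHS](big_nth 0) big_mkord sF.
apply: eq_bigr => j _; rewrite rowK /c; congr (_ *: _).
by rewrite index_uniq ?fset_uniq ?sF // valK.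
Qed.

(** Coordinates in the basis F are unique, and a generator outside G would get coordinate 0. *)
Lemma pos_genmx_subset F G x : size F = n -> genmx F \in unitmx ->
  (forall j, 0 < (x *m invmx (genmx F)) 0 j) ->
  conic_hull (F `&` G)%fset x -> (F `<=` G)%fset.
Proof.
move=> sF uF xF [c [c0 xE]]; apply/fsubsetP => w wF.
have xE' : x = \sum_(y <- F) (if y \in G then c y else 0) *: y.
  rewrite xE (big_fsetID _ (mem G) F) /= [X in _ + X]big1_fset ?addr0; last first.
    by move=> y; rewrite !inE => /andP[_ /negPf ->] _; rewrite scale0r.
  have -> : [fset y in F | y \in G]%fset = (F `&` G)%fset.
    by apply/fsetP => y; rewrite !inE.
  by apply: eq_big_seq => y; rewrite inE => /andP[_ ->].
have wn : (index w F < n)%N by have := wF; rewrite -index_mem sF.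
have := xF (Ordinal wn); rewrite xE' sum_genmx_coord // mxE /= nth_index //.
by case: (w \in G) => //; rewrite ltxx.
Qed.

(** Off the facet hyperplanes a point of C is interior to each cone containing it. Two such cones F
    and G meet in the cone over their common generators, so each set of generators contains the
    other. *)
Lemma triangulation_indicator (C : set 'rV[R]_n) V T x : triangulation C V T ->
    (forall F, F \in T -> forall j, (x *m invmx (genmx F)) 0 j != 0) ->
  \sum_(F : T) ([forall j, 0 < (x *m invmx (genmx (val F))) 0 j])%:R =
  (`[< C x >])%:R :> R.
Proof.
move=> [TV TC TI] x0.
have bas F : F \in T -> size F = n /\ genmx F \in unitmx.
  by move=> /TV[_ /basis_genmx].
case: (asboolP (C x)) => [|nC].
  rewrite -TC => -[F /= FT]; have [sF uF] := bas _ FT => xF.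
  have pF j : 0 < (x *m invmx (genmx F)) 0 j.
    by rewrite lt_def x0 //; move/(conic_hullP _ sF uF): xF; apply.
  rewrite (bigD1 [` FT]%fset) //= (introT forallP pF) big1 ?addr0 // => -[G GT] /= GF.
  case: forallP => // pG; case/negP: GF; apply/eqP/val_inj => /=.
  have [sG uG] := bas _ GT.
  have xG : conic_hull G x by apply/conic_hullP => // j; apply/ltW.
  have xFG := conj xF xG : (conic_hull F `&` conic_hull G) x.
  apply/eqP; rewrite eqEfsubset; apply/andP; split.
    by apply: (pos_genmx_subset sG uG pG); rewrite fsetIC -TI.
  by apply: (pos_genmx_subset sF uF pF); rewrite -TI.
rewrite big1 // => -[G GT] _ /=; case: forallP => // pG; case: nC.
rewrite -TC; exists G => //=; have [sG uG] := bas _ GT.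
by apply/conic_hullP => // j; apply/ltW.
Qed.

Lemma prod_fsetD (V F : {fset 'rV[R]_n}) (f : 'rV[R]_n -> R) : (F `<=` V)%fset ->
  (forall v, v \in V -> f v != 0) ->
  \prod_(v <- (V `\` F)%fset) f v = \prod_(v <- V) f v / \prod_(v <- F) f v.
Proof.
move=> FV f0; rewrite (big_fsetID _ (mem F) V) /=.
have -> : [fset y in V | y \in F]%fset = F.
  by apply/fsetP => y; rewrite !inE andb_idl // => /(fsubsetP FV).
have -> : [fset y in V | y \notin F]%fset = (V `\` F)%fset.
  by apply/fsetP => y; rewrite !inE andbC.
rewrite mulrAC mulfV ?mul1r // prodf_seq_neq0; apply/allP => v vF /=.
exact/f0/(fsubsetP FV).
Qed.

End Triangulations.

(** * Normal fans *)

Section Polytopes.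
Context {R : realType} {d : nat}.
Implicit Types (P F C : set 'rV[R]_d) (v y z : 'rV[R]_d).
Implicit Types (V S : {fset 'rV[R]_d}) (T : {fset {fset 'rV[R]_d}}).

Lemma support_fun_min P v y : P y -> (forall y', P y' -> dotv v y <= dotv v y') ->
  support_fun P v = - dotv v y.
Proof.
move=> Py ymin; congr (- _); apply/eqP; rewrite eq_le; apply/andP; split.
  by apply: ge_inf; [exists (dotv v y) => _ [y' /ymin + <-]|exists y].
apply: lb_le_inf; first by exists (dotv v y), y.
by move=> _ [y' /ymin + <-].
Qed.

(** A linear form on a convex hull is smallest at one of the finitely many generating points. *)
Lemma polytope_attains_min P v : polytope P -> P !=set0 ->
  exists2 y, P y & forall y', P y' -> dotv v y <= dotv v y'.
Proof.
move=> [S ->] [y0 [c0 [_ c01 _]]].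
have [s0 s0S] : exists s, s \in S.
  have [S0|[s sS]] := fset_0Vmem S; last by exists s.
  by move: c01; rewrite S0 big_seq_fset0 => /eqP; rewrite eq_sym oner_eq0.
case: (@Order.TotalTheory.arg_minP _ _ S [` s0S]%fset xpredT (fun s => dotv v (val s)) isT).
move=> s _ smin; exists (val s).
  exists (fun y => (y == val s)%:R); split=> [y| |]; first by rewrite ler0n.
    rewrite (big_fsetD1 (val s)) ?fsvalP //= eqxx big1_fset ?addr0 //.
    by move=> y; rewrite !inE => /andP[/negPf ->].
  rewrite (big_fsetD1 (val s)) ?fsvalP //= eqxx scale1r big1_fset ?addr0 //.
  by move=> y; rewrite !inE => /andP[/negPf -> _] _; rewrite scale0r.
move=> _ [c [cge0 c1 ->]]; rewrite dotv_sumr -[leLHS]mul1r -c1 mulr_suml.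
rewrite !big_seq; apply: ler_sum => y yS; rewrite dotvZr ler_wpM2l //.
exact: (smin [` yS]%fset).
Qed.

Lemma full_dimensional_nonempty P : full_dimensional P -> P !=set0.
Proof.
move=> fP; apply/set0P/eqP => P0.
have : affine_hull P 0 by rewrite fP.
case=> S [c [SP c1 _]]; move: c1.
have -> : S = fset0.
  by apply/eqP; rewrite -fsubset0; apply/fsubsetP => s /SP; rewrite P0.
by rewrite big_seq_fset0 => /eqP; rewrite eq_sym oner_eq0.
Qed.

Lemma support_fun_translate P v z : polytope P -> P !=set0 ->
  support_fun (translate P z) v = support_fun P v + dotv v z.
Proof.
move=> pP P0; have [y Py ymin] := polytope_attains_min v pP P0.
rewrite (support_fun_min Py ymin) (@support_fun_min _ _ (y - z)).
- by rewrite -scaleN1r dotvDr dotvZr; ring.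
- by exists y.
by move=> _ [y' Py' <-]; rewrite !dotvDr lerD2r; apply: ymin.
Qed.

(** Each v lies in the normal cone of the face on which its pairing is minimal. *)
Lemma normal_fan_complete P : polytope P -> P !=set0 ->
  \bigcup_(C in normal_fan P) C = setT.
Proof.
move=> pP P0; apply/seteqP; split=> // v _.
have [y Py ymin] := polytope_attains_min v pP P0.
pose F := P `&` [set y' | dotv v y' = dotv v y].
exists (normal_cone P F).
  exists F => //; split; first by exists y.
  by exists v, (dotv v y).
by move=> y' [_ /= ->]; apply: support_fun_min.
Qed.

(** * The dual cone as epigraph of the support function *)

Lemma dotv_consv a b v w : dotv (consv a v) (consv b w) = a * b + dotv v w :> R.
Proof.
rewrite /dotv /consv tr_row_mx mul_row_col mxE; congr (_ + _).
by rewrite tr_scalar_mx -scalar_mxM mxE mulr1n.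
Qed.

Lemma dual_cone_over P a v : polytope P -> P !=set0 ->
  dual_cone (cone_over P) (consv a v) <-> support_fun P v <= a.
Proof.
move=> pP P0; have [y Py ymin] := polytope_attains_min v pP P0.
rewrite (support_fun_min Py ymin); split=> [dv|av _ [t [y' [t0 Py' ->]]]].
  have : 0 <= dotv (consv a v) (consv 1 (1 *: y)) by apply: dv; exists 1, y.
  rewrite dotv_consv scale1r mulr1; lra.
rewrite dotv_consv dotvZr mulrC -mulrDr mulr_ge0 //.
have := ymin _ Py'; lra.
Qed.

(** On the normal cone of a face F the support function is v |-> -<v,y> for any fixed y in F. *)
Lemma support_fun_linear P C S (k : 'I_d -> R) :
  size S = d -> normal_fan P C -> conic_hull S `<=` C ->
  (forall j, 0 <= k j) ->
  support_fun P (\sum_j k j *: nth 0 S j) = \sum_j k j * support_fun P (nth 0 S j).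
Proof.
move=> sS [F [[y Fy] _] <-] SC k0.
have hE v : conic_hull S v -> support_fun P v = - dotv v y by move=> /SC; apply.
have kS (l : 'I_d -> R) : (forall j, 0 <= l j) -> conic_hull S (\sum_j l j *: nth 0 S j).
  move=> l0; exists (fun w => if insub (index w S) is Some j then l j else 0).
  split=> [w|]; first by case: insub.
  rewrite [RHS](big_nth 0) big_mkord sS; apply: eq_bigr => j _.
  by rewrite index_uniq ?fset_uniq ?sS // valK.
rewrite hE; last exact: kS.
rewrite dotvC dotv_sumr -sumrN; apply: eq_bigr => j _.
rewrite hE ?dotvZr 1?dotvC ?mulrN //.
have := kS (fun i => (i == j)%:R); rewrite (bigD1 j) //= eqxx scale1r big1 ?addr0.
  by apply=> i; rewrite ler0n.
by move=> i /negPf ->; rewrite scale0r.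
Qed.

(** Rows (1,0) and (h_P(v),v) for v in S: where h_P is linear on the cone over S, they generate the
    part of the epigraph above it. *)
Definition lift_genmx P S : 'M[R]_(1 + d) :=
  block_mx 1%:M 0 (\col_j support_fun P (nth 0 S j)) (genmx S).

Lemma det_lift_genmx P S : \det (lift_genmx P S) = \det (genmx S).
Proof. by rewrite det_lblock det1 mul1r. Qed.

Lemma lift_genmx_unit P S : (lift_genmx P S \in unitmx) = (genmx S \in unitmx).
Proof. by rewrite !unitmxE det_lift_genmx. Qed.

(** The first coordinate is the height of (a,v) above the linear interpolation of h_P from S. *)
Lemma lift_genmx_coord P S a v : genmx S \in unitmx ->
  let k := v *m invmx (genmx S) in
  consv a v *m invmx (lift_genmx P S) =
  row_mx (a - \sum_j k 0 j * support_fun P (nth 0 S j))%:M k.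
Proof.
move=> uS /=; set k := v *m _.
have uL : lift_genmx P S \in unitmx by rewrite lift_genmx_unit.
have kE : k *m genmx S = v by rewrite mulmxKV.
apply: (canLR (mulmxK uL)); rewrite /lift_genmx mul_row_block !mulmx1 mulmx0 add0r.
rewrite /consv kE {kE uL}; move: k => k; congr (row_mx _ _); apply/matrixP => i j; rewrite !ord1 !mxE.
under [X in _ = _ + X]eq_bigr do rewrite !mxE.
by rewrite !mulr1n subrK.
Qed.

Lemma forall_row_mx (Q : pred R) a (k : 'rV[R]_d) :
  [forall j, Q (row_mx (a%:M : 'M_1) k 0 j)] = Q a && [forall j, Q (k 0 j)].
Proof.
apply/forallP/andP => [h|[Qa /forallP Qk] j].
  split; first by have := h (lshift d 0); rewrite row_mxEl mxE.
  by apply/forallP => j; have := h (rshift 1 j); rewrite row_mxEr.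
by rewrite mxE; case: splitP => i _ //; rewrite ord1 mxE.
Qed.

(** The fan being complete, v is interior to exactly one cone of T; the lift of that cone contains
    (a,v) in its interior iff h_P(v) < a. *)
Lemma fan_indicator P V T a v : polytope P -> P !=set0 ->
    fan_triangulation (normal_fan P) V T ->
    (forall S, S \in T -> forall j, (consv a v *m invmx (lift_genmx P S)) 0 j != 0) ->
  \sum_(S : T) ([forall j, 0 < (consv a v *m invmx (lift_genmx P (val S))) 0 j])%:R =
  (`[< dual_cone (cone_over P) (consv a v) >])%:R :> R.
Proof.
move=> pP P0 [triT refT] gen.
have bas S : S \in T -> size S = d /\ genmx S \in unitmx.
  by case: triT => TV _ _ /TV[_ /basis_genmx].
have gen' S : S \in T ->
    (a - \sum_j (v *m invmx (genmx S)) 0 j * support_fun P (nth 0 S j) != 0) /\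
    forall j, (v *m invmx (genmx S)) 0 j != 0.
  move=> ST; have [_ uS] := bas _ ST; have := gen _ ST.
  rewrite lift_genmx_coord // => h; split=> [|j].
    by have := h (lshift d 0); rewrite row_mxEl mxE.
  by have := h (rshift 1 j); rewrite row_mxEr.
have hlin S : S \in T -> (forall j, 0 < (v *m invmx (genmx S)) 0 j) ->
    \sum_j (v *m invmx (genmx S)) 0 j * support_fun P (nth 0 S j) = support_fun P v.
  move=> ST k0; have [sS uS] := bas _ ST; have [C NC SC] := refT _ ST.
  rewrite -(support_fun_linear sS NC SC) => [|j]; last exact: ltW.
  congr (support_fun P _); rewrite -[RHS](mulmxKV uS) [RHS]mulmx_sum_row.
  by apply: eq_bigr => j _; rewrite rowK.
have ind1 : \sum_(S : T) ([forall j, 0 < (v *m invmx (genmx (val S))) 0 j])%:R = 1 :> R.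
  rewrite (triangulation_indicator triT); last by move=> S /gen'[].
  by rewrite normal_fan_complete // asboolT.
(* If a = h_P(v), the first coordinate of (a,v) in the lifted cone around it would be 0, against
   genericity. *)
have -> : `[< dual_cone (cone_over P) (consv a v) >] = (support_fun P v < a).
  apply/asboolP/idP => [|/ltW]; rewrite dual_cone_over // le_eqVlt => /orP[/eqP ha|//].
  suff : (1 : R) = 0 by move/eqP; rewrite oner_eq0.
  rewrite -[LHS]ind1 big1 // => -[S ST] _ /=; case: forallP => // k0.
  by have [] := gen' _ ST; rewrite hlin // ha subrr eqxx.
rewrite -[RHS]mulr1 -[X in _ * X]ind1 mulr_sumr; apply: eq_bigr => -[S ST] _ /=.
have [_ uS] := bas _ ST.
rewrite lift_genmx_coord // (forall_row_mx (fun r => 0 < r)) /= subr_gt0 -natrM mulnb.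
by case: forallP => [k0|_]; rewrite ?andbF // hlin.
Qed.

Definition lift_gen P v : 'rV[R]_(1 + d) := consv (support_fun P v) v.

Lemma lift_gen_inj P : injective (lift_gen P).
Proof. by move=> v w /eq_row_mx[]. Qed.

Lemma prod_lift_genmx P S z : size S = d ->
  \prod_j dotv (row j (lift_genmx P S)) (consv 1 z) =
  \prod_(v <- S) dotv (lift_gen P v) (consv 1 z).
Proof.
move=> sS; rewrite big_split_ord /= big_ord1.
have -> : row (lshift d 0) (lift_genmx P S) = consv 1 0.
  rewrite /lift_genmx /block_mx rowKu row_row_mx /consv row0; congr (row_mx _ _).
  by apply/matrixP => i k; rewrite !ord1 !mxE.
rewrite dotv_consv mulr1 dotvC dotv0r addr0 mul1r (big_nth 0) big_mkord sS.
apply: eq_bigr => j _; congr (dotv _ _).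
rewrite /lift_genmx /block_mx rowKd row_row_mx rowK /lift_gen /consv; congr (row_mx _ _).
by apply/matrixP => i k; rewrite !ord1 !mxE.
Qed.

(** Taken with sign + for T' and - for the lifts of T, the indicator functions cancel off the facet
    hyperplanes, and additivity of weights applies. *)
Lemma lifted_cone_weights P V T (T' : {fset {fset 'rV[R]_(1 + d)}}) z :
    polytope P -> P !=set0 ->
    fan_triangulation (normal_fan P) V T ->
    triangulation (dual_cone (cone_over P)) (lifted_generators P V) T' ->
    (forall v, v \in V -> dotv (lift_gen P v) (consv 1 z) != 0) ->
  \sum_(G : T') absdet (val G) / \prod_(w <- val G) dotv w (consv 1 z) =
  \sum_(S : T) absdet (val S) / \prod_(v <- val S) dotv (lift_gen P v) (consv 1 z).
Proof.
move=> pP P0 fanT triT' u0; set u := consv 1 z in u0 *.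
have basT S : S \in T -> [/\ (S `<=` V)%fset, size S = d & genmx S \in unitmx].
  by case: fanT => -[TV _ _] _ /TV[SV /basis_genmx[]].
have basT' G : G \in T' ->
    [/\ (G `<=` lifted_generators P V)%fset, size G = (1 + d)%N & genmx G \in unitmx].
  by case: triT' => TV _ _ /TV[SV /basis_genmx[]].
have u0' w : w \in lifted_generators P V -> dotv w u != 0.
  by move=> /imfsetP[v /= vV ->]; apply: u0.
pose gen (i : T' + T) : 'M[R]_(1 + d) :=
  match i with inl G => genmx (val G) | inr K => lift_genmx P (val K) end.
pose c (i : T' + T) : R := if i is inl _ then 1 else -1.
have ug i : gen i \in unitmx.
  case: i => i /=; first by have [] := basT' _ (fsvalP i).
  by rewrite lift_genmx_unit; have [] := basT _ (fsvalP i).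
pose M i := covmx (gen i).
have wT' (G : T') : \prod_j dotv (row j (genmx (val G))) u = \prod_(w <- val G) dotv w u.
  by apply: prod_genmx; have [] := basT' _ (fsvalP G).
have wT (S : T) : \prod_j dotv (row j (lift_genmx P (val S))) u =
                  \prod_(v <- val S) dotv (lift_gen P v) u.
  by apply: prod_lift_genmx; have [] := basT _ (fsvalP S).
pose H := flatten [seq mxrows (M i) | i <- enum ((T' + T)%type : finType)].
have MU i : M i \in unitmx by rewrite covmx_unit.
have : \sum_i c i * cone_weight (M i) u = 0.
  apply: (@cone_relation_simplicial R (1 + d) _ 'I_0 c M (fun=> 0) (fun=> [::]) H u).
  - exact: MU.
  - move=> i j; have -> : (u *m invmx (M i)) 0 j = dotv (row j (gen i)) u.
      rewrite /M /covmx invmxK dotvC /dotv tr_row [RHS]mxE mxE.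
      by apply: eq_bigr => k _; rewrite !mxE.
    have : \prod_j dotv (row j (gen i)) u != 0; last by move/prodf_neq0; apply.
    case: i => i /=; rewrite ?wT' ?wT prodf_seq_neq0; apply/allP => w wi /=.
      have [GV _ _] := basT' _ (fsvalP i); exact/u0'/(fsubsetP GV).
    have [SV _ _] := basT _ (fsvalP i); exact/u0/(fsubsetP SV).
  - by case.
  - move=> _ /flatten_mapP[i _ /mapP[j _ ->]]; apply/eqP => Mij.
    have := congr1 (mulmxr (invmx (M i))) Mij; rewrite /= -row_mul mulmxV // mul0mx.
    by move/rowP/(_ j)/eqP; rewrite !mxE eqxx oner_eq0.
  - move=> x xH; rewrite [X in _ + X]big1 ?addr0 => [|k _]; last by rewrite mul0r.
    have [y xE] : exists y : 'rV[R]_(1 + d), x = y^T by exists x^T; rewrite trmxK.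
    have gy i j : (y *m invmx (gen i)) 0 j != 0.
      rewrite -covmx_coord -xE; apply: xH; apply/flatten_mapP.
      by exists i; rewrite ?mem_enum //; apply: map_f; rewrite mem_enum.
    have yE : y = consv (y 0 0) (rsubmx y).
      rewrite -[LHS]hsubmxK /consv; congr (row_mx _ _).
      by rewrite [LHS]mx11_scalar mxE lshift0.
    have posE i : pos_on (mxrows (M i)) x = [forall j, 0 < (y *m invmx (gen i)) 0 j].
      by rewrite xE pos_on_covmx.
    rewrite big_sumType /=; under eq_bigr do rewrite mul1r posE.
    under [X in _ + X]eq_bigr do rewrite mulN1r posE.
    rewrite sumrN (triangulation_indicator triT').
      rewrite yE (fan_indicator pP P0 fanT) ?subrr // => S ST j.
      by have := gy (inr [` ST]%fset) j; rewrite {1}yE.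
    by move=> G GT j; exact: (gy (inl [` GT]%fset) j).
rewrite big_sumType /= /M /c.
under eq_bigr do rewrite mul1r cone_weight_covmx wT' -absdetE.
under [X in _ + X]eq_bigr do rewrite mulN1r cone_weight_covmx wT det_lift_genmx -absdetE.
by rewrite sumrN => /eqP; rewrite subr_eq0 => /eqP.
Qed.

(** * Comparison of the adjoint with the dual volume numerator *)

Definition lifted_vol_num P V T (u : 'rV[R]_(1 + d)) : R :=
  \sum_(S <- T) absdet S * \prod_(v <- (V `\` S)%fset) dotv (lift_gen P v) u.

Lemma dual_vol_numE P V T z : polytope P -> P !=set0 ->
  dual_vol_num P V T z = lifted_vol_num P V T (consv 1 z).
Proof.
move=> pP P0; apply: eq_bigr => S _; congr (_ * _); apply: eq_bigr => v _.
by rewrite dotv_consv mulr1 support_fun_translate.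
Qed.

(** Both sides are the respective sum of weights times the product over all lifted generators. *)
Lemma adjoint_eq_generic P V T (T' : {fset {fset 'rV[R]_(1 + d)}}) z :
    polytope P -> P !=set0 ->
    fan_triangulation (normal_fan P) V T ->
    triangulation (dual_cone (cone_over P)) (lifted_generators P V) T' ->
    (forall v, v \in V -> dotv (lift_gen P v) (consv 1 z) != 0) ->
  adjoint (lifted_generators P V) T' (consv 1 z) = lifted_vol_num P V T (consv 1 z).
Proof.
move=> pP P0 fanT triT' u0; set u := consv 1 z in u0 *.
have u0' w : w \in lifted_generators P V -> dotv w u != 0.
  by move=> /imfsetP[v /= vV ->]; apply: u0.
have DE : \prod_(w <- lifted_generators P V) dotv w u =
          \prod_(v <- V) dotv (lift_gen P v) u.
  by rewrite big_imfset //= => v w _ _; apply: lift_gen_inj.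
have -> : adjoint (lifted_generators P V) T' u =
    \prod_(v <- V) dotv (lift_gen P v) u *
    \sum_(G : T') absdet (val G) / \prod_(w <- val G) dotv w u.
  rewrite /adjoint big_seq_fsetE mulr_sumr; apply: eq_bigr => G _.
  have [GW _] : (val G `<=` lifted_generators P V)%fset /\ basis_of fullv (val G).
    by case: triT' => TV _ _; apply/TV/fsvalP.
  by rewrite prod_fsetD // DE mulrCA.
rewrite (lifted_cone_weights pP P0 fanT triT' u0).
rewrite /lifted_vol_num [RHS]big_seq_fsetE mulr_sumr; apply: eq_bigr => S _.
have [SV _] : (val S `<=` V)%fset /\ basis_of fullv (val S).
  by case: fanT => -[TV _ _] _; apply/TV/fsvalP.
by rewrite (prod_fsetD (f := fun v => dotv (lift_gen P v) u)) // mulrCA.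
Qed.

(* Both sides are polynomial along the line z + t zeta, and agree wherever the
   denominator, nonzero along that line for a suitable zeta, does not vanish. *)
Lemma adjoint_eq P V T (T' : {fset {fset 'rV[R]_(1 + d)}}) z :
    polytope P -> P !=set0 -> (forall v, v \in V -> v != 0) ->
    fan_triangulation (normal_fan P) V T ->
    triangulation (dual_cone (cone_over P)) (lifted_generators P V) T' ->
  adjoint (lifted_generators P V) T' (consv 1 z) = lifted_vol_num P V T (consv 1 z).
Proof.
move=> pP P0 V0 fanT triT'.
have [zeta zetaV] : exists zeta : 'rV[R]_d, forall v, v \in V -> dotv zeta v != 0.
  have [|zeta zV] := @exists_nonorthogonal R d [seq v^T | v : 'rV[R]_d <- V].
    by move=> _ /mapP[v /V0 v0 ->]; rewrite -trmx0 (inj_eq trmx_inj).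
  by exists zeta => v vV; apply: zV; apply: map_f.
(* The pairing with w along the line (1, z + t zeta), as a polynomial in t. *)
pose q (w : 'rV[R]_(1 + d)) : {poly R} :=
  (dotv w (consv 1 z))%:P + dotv w (consv 0 zeta) *: 'X.
have qE w t : (q w).[t] = dotv w (consv 1 (z + t *: zeta)).
  have -> : consv 1 (z + t *: zeta) = consv 1 z + t *: consv 0 zeta.
    by rewrite /consv scale_row_mx add_row_mx scale_scalar_mx mulr0 raddf0 addr0.
  by rewrite !hornerE dotvDr dotvZr mulrC.
pose f1 : {poly R} := \sum_(G <- T') (absdet G)%:P *
  \prod_(w <- (lifted_generators P V `\` G)%fset) q w.
pose f2 : {poly R} := \sum_(S <- T) (absdet S)%:P *
  \prod_(v <- (V `\` S)%fset) q (lift_gen P v).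
pose D : {poly R} := \prod_(v <- V) q (lift_gen P v).
have f1E t : f1.[t] = adjoint (lifted_generators P V) T' (consv 1 (z + t *: zeta)).
  rewrite horner_sum; apply: eq_bigr => G _; rewrite hornerM hornerC horner_prod.
  by congr (_ * _); apply: eq_bigr => w _; rewrite qE.
have f2E t : f2.[t] = lifted_vol_num P V T (consv 1 (z + t *: zeta)).
  rewrite horner_sum; apply: eq_bigr => G _; rewrite hornerM hornerC horner_prod.
  by congr (_ * _); apply: eq_bigr => w _; rewrite qE.
(* The coefficient of X in [q (lift_gen P v)] is <v,zeta>, nonzero by the choice of [zeta]. *)
have D0 : D != 0.
  rewrite prodf_seq_neq0; apply/allP => v vV /=; apply/eqP => q0.
  have /eqP := congr1 (fun p : {poly R} => p`_1) q0.
  rewrite coefD coefC coefZ coefX mulr1 add0r coef0 dotv_consv mulr0 add0r dotvC.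
  exact/negP/zetaV.
suff : (f1 - f2) * D = 0.
  move/eqP; rewrite mulf_eq0 (negPf D0) orbF subr_eq0 => /eqP f12.
  by have := f1E 0; rewrite f12 f2E scale0r addr0.
apply/eqP/negPn/negP => /exists_nonroot[t]; rewrite /root hornerM mulf_eq0 negb_or.
move=> /andP[+ Dt]; rewrite hornerD hornerN f1E f2E (adjoint_eq_generic pP P0 fanT triT') ?subrr ?eqxx //.
move=> v vV; rewrite -qE; move: Dt; rewrite horner_prod prodf_seq_neq0 => /allP.
exact.
Qed.

End Polytopes.

Theorem theorem4p3 (R : realType) (d : nat) (P : set 'rV[R]_d)
    (V : {fset 'rV[R]_d}) (T : {fset {fset 'rV[R]_d}})
    (T' : {fset {fset 'rV[R]_(1 + d)}})
    (polyP : polytope P) (fullP : full_dimensional P)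
    (genV : ray_generators (normal_fan P) V)
    (triT : fan_triangulation (normal_fan P) V T)
    (triT' : triangulation (dual_cone (cone_over P))
               (lifted_generators P V) T') :
  (forall z : 'rV[R]_d, dual_vol_den P V z != 0 ->
     dual_vol P V T z =
       adjoint (lifted_generators P V) T' (consv 1 z) / dual_vol_den P V z) /\
  (forall z : 'rV[R]_d,
     adjoint (lifted_generators P V) T' (consv 1 z) = dual_vol_num P V T z).
Proof.
have P0 := full_dimensional_nonempty fullP.
have V0 v : v \in V -> v != 0 by case: genV => + _ => /[apply] -[].
have adjE z : adjoint (lifted_generators P V) T' (consv 1 z) = dual_vol_num P V T z.
  by rewrite dual_vol_numE //; apply: adjoint_eq.
by split=> // z _; rewrite adjE.
Qed.
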